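(* Assume $|\zeta|\leq1$, $\alpha\in[0,1)$, and $f(z)=z+\sum_{n=2}^{\infty}a_nz^n\in S_\zeta^*(\alpha)$. Then, for $n\geq2$ and with $a_1=1$, $$|a_n|^2\leq\frac{\displaystyle\sum_{k=1}^{n-1}\left\{\left|(1-2\alpha)+[k]_\zeta\right|^2-\left|[k]_\zeta-1\right|^2\right\}|a_k|^2}{\left|[n]_\zeta-1\right|^2}.$$
   Context: Let $\mathbb{D}=\{z\in\mathbb{C}:|z|<1\}$ and let $\mathcal{A}$ be the family of analytic functions $f$ on $\mathbb{D}$ of the form $f(z)=z+a_2z^2+a_3z^3+\cdots$ (so $a_1=1$). Here $\zeta\in\mathbb{C}$ is a complex parameter with $|\zeta|\le1$, and for an integer $n\ge1$, $[n]_\zeta=1+\zeta+\zeta^2+\cdots+\zeta^{n-1}$. The operator $D_\zeta$ is defined on $\mathcal{A}$ by $D_\zeta f(z)=\frac1z\left\{f(z)\ast\frac{z}{(1-\zeta z)(1-z)}\right\}$, where $\ast$ is the Hadamard product (coefficientwise product of power series); equivalently $D_\zeta f(z)=\sum_{n\ge1}[n]_\zeta a_nz^{n-1}$. For $\alpha\in[0,1)$, the class $S_\zeta^*(\alpha)$ of $\zeta$-starlike functions of order $\alpha$ consists of all $f\in\mathcal{A}$ with $\operatorname{Re}\frac{zD_\zeta f(z)}{f(z)}>\alpha$ for all $z\in\mathbb{D}$ (the quotient at $z=0$ being understood as its limit $1$).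
   Formalization: The formal theorem assumes in addition that [n]_ζ ≠ 1, since otherwise (for example ζ = 0, or ζ^(n-1) = 1 with ζ ≠ 1) the denominator |[n]_ζ − 1|² is zero and the right-hand side is undefined. *)

(* Defs.v *)
From Stdlib Require Import Reals.
From Coquelicot Require Import Coquelicot.
Open Scope R_scope.

(* Analyticity on the unit disk D is expressed by convergence, on all of D, of
   the power series at 0. *)
Definition expands_on_disk (a : nat -> C) (f : C -> C) : Prop :=
  forall z : C, Cmod z < 1 -> @is_pseries C_AbsRing C_NormedModule a z (f z).

Definition analytic_on_disk (f : C -> C) : Prop :=
  exists a : nat -> C, expands_on_disk a f.

Definition normalized_expansion (a : nat -> C) (f : C -> C) : Prop :=
  a 0%nat = RtoC 0 /\ a 1%nat = RtoC 1 /\ expands_on_disk a f.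

Definition class_A (f : C -> C) : Prop :=
  exists a : nat -> C, normalized_expansion a f.

(* [n]_zeta = 1 + zeta + ... + zeta^(n-1) *)
Fixpoint bracket (zeta : C) (n : nat) : C :=
  match n with
  | O => RtoC 0
  | S m => (bracket zeta m + zeta ^ m)%C
  end.

(* h is the Hadamard product f * g. *)
Definition is_hadamard (f g h : C -> C) : Prop :=
  exists a b : nat -> C,
    expands_on_disk a f /\ expands_on_disk b g /\
    expands_on_disk (fun n => (a n * b n)%C) h.

Definition kernel (zeta z : C) : C := (z / ((1 - zeta * z) * (1 - z)))%C.

(* g = D_zeta f on D.  The equation g(z) = (1/z) h(z) is written z g(z) = h(z)
   with g analytic, which also determines g(0). *)
Definition is_D (zeta : C) (f g : C -> C) : Prop :=
  analytic_on_disk g /\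
  exists h : C -> C,
    is_hadamard f (kernel zeta) h /\
    forall z : C, Cmod z < 1 -> h z = (z * g z)%C.

(* z g(z) / f(z), with its limit value 1 at z = 0. *)
Definition starlike_quotient (f g : C -> C) (z : C) : C :=
  if Ceq_dec z 0 then RtoC 1 else (z * g z / f z)%C.

(* Division in C is total and w / 0 = 0: since alpha >= 0 below, the inequality
   fails wherever f vanishes off the origin, so membership forces f z <> 0
   there, i.e. the quotient is a genuine one. *)
Definition zeta_starlike (zeta : C) (alpha : R) (f : C -> C) : Prop :=
  class_A f /\
  exists g : C -> C,
    is_D zeta f g /\
    forall z : C, Cmod z < 1 -> alpha < Re (starlike_quotient f g z).

(* Main.v *)
Require Import Defs.
From Stdlib Require Import Reals Lra Lia Psatz ClassicalEpsilon.
From Coquelicot Require Import Coquelicot.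
Open Scope R_scope.

(** Write [h = z D_zeta f], whose Taylor coefficients are [[k]_zeta a_k]
    ([kernel_coef], by comparing coefficients in the functional equation of the
    kernel).  The condition [Re (h / f) > alpha] implies that
    [h + (1 - 2 alpha) f] has no zero off the origin and dominates [h - f] in
    modulus ([half_plane_domination]).  After division by [z] one has two power series
    [F] and [G] on the disk with [F(0) = 0], [|F| <= |G|] and [G] free of zeros,
    and the coefficients of [F] and [G] are [([k]_zeta - 1) a_k] and
    [((1 - 2 alpha) + [k]_zeta) a_k].

    The theorem is then Clunie's comparison ([dominated_coefficients]): the sum
    of [|F_k|^2] over [k <= m] is at most the sum of [|G_k|^2] over [k < m].  Let
    [T] be the truncation of [G] at order [m] and [phi = T F / G].  As [F / G]
    vanishes at 0, [phi] has the Taylor coefficients of [F] up to order [m], and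
    [|phi| <= |T|].  Integrating the squares over the circle of radius [r] and
    letting [r] tend to 1 gives the comparison.

    The integrals are computed by Parseval's identity in a finite form
    ([parseval]): if [phi = c_0 + ... + c_(n-1) z^(n-1) + z^n psi] with [psi]
    holomorphic, the mean of [|phi|^2] is the sum of the [|c_k|^2 r^(2k)] plus
    [r^(2n)] times the mean of [|psi|^2].  It follows by induction on [n] from
    the mean value property, because the cross term in [|c + z u|^2] is the real
    part of a holomorphic function vanishing at 0.  The mean value property
    ([holomorphic_mean_value]) holds because, by the Cauchy-Riemann equations,
    the radial derivative of the circle integral is the integral of an angular
    derivative.  So all that is needed of [psi] is that it is C^1-holomorphic;
    here it is built from power series by sums, products and one inverse, and
    neither the power series of [1 / G] nor Cauchy's theorem is used. *)

(** * Complex power series on the unit disk *)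

(** The partial sum of [a_k z ^ k] over [k <= N]. *)
Fixpoint psum (a : nat -> C) (z : C) (N : nat) : C :=
  match N with
  | O => a O
  | S M => (psum a z M + a (S M) * z ^ S M)%C
  end.

(** Convergence of a complex sequence, in terms of the modulus. *)
Definition clim (s : nat -> C) (l : C) : Prop :=
  is_lim_seq (fun n => Cmod (s n - l)) 0.

Lemma pow_n_Cpow (z : C) (k : nat) : @pow_n C_Ring z k = (z ^ k)%C.
Proof.
induction k as [|k IH]; [reflexivity|].
simpl pow_n; rewrite IH; rewrite Cpow_S; reflexivity.
Qed.

Lemma sum_n_psum (a : nat -> C) (z : C) (N : nat) :
  sum_n (fun k => @scal C_Ring C_NormedModule (@pow_n C_Ring z k) (a k)) N
  = psum a z N.
Proof.
induction N as [|N IH].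
- rewrite sum_O. change (1 * a O = a O)%C. ring.
- rewrite sum_Sn, IH, pow_n_Cpow. cbn [psum].
  change (psum a z N + z ^ S N * a (S N) = psum a z N + a (S N) * z ^ S N)%C. ring.
Qed.

Lemma clim_filterlim (s : nat -> C) (l : C) :
  filterlim s eventually (@locally C_UniformSpace l) <-> clim s l.
Proof.
unfold clim.
rewrite <- (is_lim_seq_spec (fun n => Cmod (s n - l)) 0).
split.
- intros H eps.
  destruct (proj1 (@filterlim_locally_ball_norm C_AbsRing nat C_NormedModule eventually _ s l) H eps)
    as [N HN].
  exists N; intros n Hn. specialize (HN n Hn).
  change (Cmod (s n - l) < eps) in HN.
  rewrite Rminus_0_r, Rabs_pos_eq; [exact HN | apply Cmod_ge_0].
- intros H.
  apply (proj2 (@filterlim_locally_ball_norm C_AbsRing nat C_NormedModule eventually _ s l)).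
  intros eps. destruct (H eps) as [N HN]. exists N; intros n Hn.
  specialize (HN n Hn).
  rewrite Rminus_0_r, Rabs_pos_eq in HN; [exact HN | apply Cmod_ge_0].
Qed.

Lemma is_pseries_clim (a : nat -> C) (z l : C) :
  @is_pseries C_AbsRing C_NormedModule a z l <-> clim (psum a z) l.
Proof.
rewrite <- clim_filterlim. unfold is_pseries, is_series.
split; apply filterlim_ext; intros N; [|symmetry]; apply sum_n_psum.
Qed.

Lemma clim_unique (s : nat -> C) (l l' : C) : clim s l -> clim s l' -> l = l'.
Proof.
unfold clim; intros H H'.
apply Ceq_minus, Cmod_eq_0, Rle_antisym; [|apply Cmod_ge_0].
assert (H2 := is_lim_seq_plus' _ _ _ _ H H').
rewrite Rplus_0_r in H2.
refine (is_lim_seq_le (fun _ => Cmod (l - l')) _ (Cmod (l - l')) 0 _ (is_lim_seq_const _) H2).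
intros n; simpl.
replace (l - l')%C with (- (s n - l) + (s n - l'))%C by ring.
rewrite <- (Cmod_opp (s n - l)). apply Cmod_triangle.
Qed.

Lemma clim_bound (s : nat -> C) (l : C) (K : R) :
  clim s l -> (forall n, Cmod (s n) <= K) -> Cmod l <= K.
Proof.
unfold clim; intros H HK.
assert (H2 := is_lim_seq_plus' _ _ _ _ (is_lim_seq_const K) H).
rewrite Rplus_0_r in H2.
refine (is_lim_seq_le (fun _ => Cmod l) _ (Cmod l) K _ (is_lim_seq_const _) H2).
intros n; simpl.
replace l with (s n + - (s n - l))%C at 1 by ring.
eapply Rle_trans; [apply Cmod_triangle|].
rewrite Cmod_opp. specialize (HK n); lra.
Qed.

Lemma clim_ext (s t : nat -> C) (l : C) : (forall n, s n = t n) -> clim s l -> clim t l.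
Proof.
intros E; apply is_lim_seq_ext; intros n; now rewrite E.
Qed.

Lemma clim_incr (s : nat -> C) (l : C) : clim s l -> clim (fun n => s (S n)) l.
Proof. exact (proj1 (is_lim_seq_incr_1 (fun n => Cmod (s n - l)) 0)). Qed.

Lemma clim_plus (s t : nat -> C) (l m : C) :
  clim s l -> clim t m -> clim (fun n => s n + t n)%C (l + m)%C.
Proof.
unfold clim; intros H H'.
assert (H2 := is_lim_seq_plus' _ _ _ _ H H').
rewrite Rplus_0_r in H2.
refine (is_lim_seq_le_le (fun _ => 0) _ _ 0 _ (is_lim_seq_const _) H2).
intros n; split; [apply Cmod_ge_0|].
replace (s n + t n - (l + m))%C with ((s n - l) + (t n - m))%C by ring.
apply Cmod_triangle.
Qed.

Lemma clim_scal (c : C) (s : nat -> C) (l : C) :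
  clim s l -> clim (fun n => c * s n)%C (c * l)%C.
Proof.
unfold clim; intros H.
assert (H2 := is_lim_seq_scal_l _ (Cmod c) _ H).
simpl in H2. rewrite Rmult_0_r in H2.
revert H2; apply is_lim_seq_ext; intros n.
rewrite <- Cmod_mult; f_equal; ring.
Qed.

(** Abel's bound: convergence on the disk makes the coefficients
    [O(rho ^ (- k))] for every [rho < 1]. *)
Lemma expands_coef_bounded (a : nat -> C) (f : C -> C) (rho : R) :
  expands_on_disk a f -> 0 <= rho < 1 ->
  exists M, forall k, Rabs (Cmod (a k) * rho ^ k) <= M.
Proof.
intros Ha Hr.
assert (Hz : Cmod (RtoC rho) < 1) by (rewrite Cmod_R, Rabs_pos_eq; lra).
assert (H := Ha _ Hz).
apply is_pseries_clim, clim_filterlim in H.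
destruct (@filterlim_bounded C_AbsRing C_NormedModule (psum a rho)
  (ex_intro (fun l => filterlim _ _ (locally l)) _ H)) as [M HM].
assert (HM' : forall n, Cmod (psum a rho n) <= M) by exact HM.
exists (2 * M); intros k.
assert (E : Cmod (a k) * rho ^ k = Cmod (a k * RtoC rho ^ k)).
{ now rewrite Cmod_mult, Cmod_pow, Cmod_R, (Rabs_pos_eq rho) by lra. }
rewrite E, Rabs_pos_eq by apply Cmod_ge_0.
assert (H0 := Cmod_ge_0 (psum a rho O)). assert (H1 := HM' O).
destruct k as [|k].
- replace (a O * RtoC rho ^ 0)%C with (psum a rho O) by (simpl; ring). lra.
- replace (a (S k) * RtoC rho ^ S k)%C with (psum a rho (S k) + - psum a rho k)%C
    by (cbn [psum]; ring).
  eapply Rle_trans; [apply Cmod_triangle|]. rewrite Cmod_opp.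
  assert (H2 := HM' (S k)). assert (H3 := HM' k). lra.
Qed.

Lemma expands_CV_radius (a : nat -> C) (f : C -> C) (rho : R) :
  expands_on_disk a f -> 0 <= rho < 1 ->
  Rbar_lt (Rabs rho) (CV_radius (fun k => Cmod (a k))).
Proof.
intros Ha Hr.
apply Rbar_lt_le_trans with ((1 + rho) / 2).
- simpl; rewrite Rabs_pos_eq; lra.
- apply (proj1 (CV_radius_bounded (fun k => Cmod (a k)))).
  apply (expands_coef_bounded a f); [exact Ha | lra].
Qed.

(** The coefficients of the termwise derivative. *)
Definition dcoef (a : nat -> C) (k : nat) : C := (RtoC (INR (S k)) * a (S k))%C.

Lemma Cmod_dcoef (a : nat -> C) (k : nat) :
  Cmod (dcoef a k) = PS_derive (fun k => Cmod (a k)) k.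
Proof.
unfold dcoef, PS_derive.
rewrite Cmod_mult, Cmod_R, Rabs_pos_eq; [reflexivity | apply pos_INR].
Qed.

Lemma psum_ex_lim (a : nat -> C) (z : C) :
  ex_series (fun k => Cmod (a k) * Cmod z ^ k) -> exists l, clim (psum a z) l.
Proof.
intros H.
destruct (@ex_series_le C_AbsRing C_CompleteNormedModule
  (fun k => a k * z ^ k)%C _ (fun k => Req_le _ _ (eq_trans (Cmod_mult _ _)
     (f_equal (Rmult (Cmod (a k))) (Cmod_pow _ _)))) H) as [l Hl].
exists l. apply is_pseries_clim.
revert Hl; apply is_series_ext. intros k.
change (a k * z ^ k = z ^ k * a k)%C. apply Cmult_comm.
Qed.

Lemma Cpow_diff_bound (z w : C) (rho : R) (k : nat) :
  Cmod z <= rho -> Cmod w <= rho ->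
  Cmod (w ^ S k - z ^ S k) <= INR (S k) * rho ^ k * Cmod (w - z).
Proof.
intros Hz Hw.
assert (Hr : 0 <= rho) by (eapply Rle_trans; [apply Cmod_ge_0 | exact Hz]).
induction k as [|k IH].
- simpl INR. rewrite !Cpow_1_r. simpl; lra.
- replace (w ^ S (S k) - z ^ S (S k))%C
    with (z * (w ^ S k - z ^ S k) + (w - z) * w ^ S k)%C
    by (rewrite !(Cpow_S _ (S k)); ring).
  eapply Rle_trans; [apply Cmod_triangle|].
  rewrite !Cmod_mult, Cmod_pow.
  assert (H1 : Cmod z * Cmod (w ^ S k - z ^ S k)
     <= rho * (INR (S k) * rho ^ k * Cmod (w - z))).
  { apply Rmult_le_compat; auto using Cmod_ge_0. }
  assert (H2 : Cmod (w - z) * Cmod w ^ S k <= Cmod (w - z) * rho ^ S k).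
  { apply Rmult_le_compat_l; [apply Cmod_ge_0|].
    apply pow_incr; split; [apply Cmod_ge_0 | exact Hw]. }
  rewrite (S_INR (S k)). simpl pow in *. nra.
Qed.

Lemma Cpow_taylor_bound (z w : C) (rho : R) (k : nat) :
  Cmod z <= rho -> Cmod w <= rho ->
  Cmod (w ^ S (S k) - z ^ S (S k) - RtoC (INR (S (S k))) * z ^ S k * (w - z))
  <= INR (S k) * INR (S (S k)) * rho ^ k * Cmod (w - z) ^ 2.
Proof.
intros Hz Hw.
assert (Hr : 0 <= rho) by (eapply Rle_trans; [apply Cmod_ge_0 | exact Hz]).
induction k as [|k IH].
- replace (w ^ 2 - z ^ 2 - RtoC (INR 2) * z ^ 1 * (w - z))%C with ((w - z) * (w - z))%C.
  + rewrite Cmod_mult. simpl. assert (H := Cmod_ge_0 (w - z)). nra.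
  + simpl INR. rewrite RtoC_plus. simpl; ring.
- replace (w ^ S (S (S k)) - z ^ S (S (S k)) - RtoC (INR (S (S (S k)))) * z ^ S (S k) * (w - z))%C
    with (z * (w ^ S (S k) - z ^ S (S k) - RtoC (INR (S (S k))) * z ^ S k * (w - z))
          + (w - z) * (w ^ S (S k) - z ^ S (S k)))%C
    by (rewrite (S_INR (S (S k))), RtoC_plus, !(Cpow_S _ (S (S k))), !(Cpow_S _ (S k)); ring).
  eapply Rle_trans; [apply Cmod_triangle|].
  rewrite !Cmod_mult.
  assert (H0 := Cpow_diff_bound z w rho (S k) Hz Hw).
  set (h := Cmod (w - z)) in *.
  assert (Hh : 0 <= h) by apply Cmod_ge_0.
  assert (H1 := Rmult_le_compat _ _ _ _ (Cmod_ge_0 _) (Cmod_ge_0 _) Hz IH).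
  assert (H2 := Rmult_le_compat_l _ _ _ Hh H0).
  eapply Rle_trans; [apply Rplus_le_compat; [exact H1 | exact H2]|].
  rewrite (S_INR (S (S k))), (S_INR (S k)). simpl pow.
  assert (Hk := pos_INR (S k)).
  assert (Hp : 0 <= rho * rho ^ k * (h * h))
    by (apply Rmult_le_pos; [apply Rmult_le_pos; [|apply pow_le]|]; nra).
  nra.
Qed.

(** The Taylor remainder of a partial sum is quadratic, with a constant bounded by
    the second derivative of the series of moduli at [rho]. *)
Lemma psum_taylor (a : nat -> C) (z w : C) (rho : R) (N : nat) :
  Cmod z <= rho -> Cmod w <= rho ->
  Cmod (psum a w (S (S N)) - psum a z (S (S N)) - psum (dcoef a) z (S N) * (w - z))
  <= sum_n (fun k => PS_derive (PS_derive (fun k => Cmod (a k))) k * rho ^ k) N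
     * Cmod (w - z) ^ 2.
Proof.
intros Hz Hw.
assert (Hr : 0 <= rho) by (eapply Rle_trans; [apply Cmod_ge_0 | exact Hz]).
assert (T : forall k,
  Cmod (a (S (S k)) * (w ^ S (S k) - z ^ S (S k) - RtoC (INR (S (S k))) * z ^ S k * (w - z)))
  <= PS_derive (PS_derive (fun k => Cmod (a k))) k * rho ^ k * Cmod (w - z) ^ 2).
{ intros k. rewrite Cmod_mult. unfold PS_derive.
  assert (H := Rmult_le_compat_l _ _ _ (Cmod_ge_0 (a (S (S k)))) (Cpow_taylor_bound z w rho k Hz Hw)).
  eapply Rle_trans; [exact H|]. right; ring. }
induction N as [|N IH].
- rewrite sum_O. eapply Rle_trans; [|apply T]. right. f_equal.
  unfold psum, dcoef. simpl INR. ring.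
- rewrite sum_Sn.
  replace (psum a w (S (S (S N))) - psum a z (S (S (S N))) - psum (dcoef a) z (S (S N)) * (w - z))%C
   with ((psum a w (S (S N)) - psum a z (S (S N)) - psum (dcoef a) z (S N) * (w - z))
    + a (S (S (S N))) * (w ^ S (S (S N)) - z ^ S (S (S N)) - RtoC (INR (S (S (S N)))) * z ^ S (S N) * (w - z)))%C.
  + eapply Rle_trans; [apply Cmod_triangle|].
    eapply Rle_trans; [apply Rplus_le_compat; [exact IH | apply T]|].
    right; unfold plus; simpl; ring.
  + cbn [psum]. change (dcoef a (S (S N))) with (RtoC (INR (S (S (S N)))) * a (S (S (S N))))%C. ring.
Qed.

(** * A C^1 form of holomorphy *)

(** [u] is complex differentiable on the disk with derivative [u'], with an
    error term that is quadratic, locally uniformly in the base point.  This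
    makes [u'] locally Lipschitz, so no separate continuity is required. *)
Definition hol (u u' : C -> C) : Prop :=
  forall c : C, Cmod c < 1 ->
  exists delta K : R, 0 < delta /\ 0 <= K /\
  forall z w : C, Cmod (z - c) < delta -> Cmod (w - c) < delta ->
  Cmod (u w - u z - u' z * (w - z)) <= K * Cmod (w - z) ^ 2.

Definition holomorphic (u : C -> C) : Prop := exists u', hol u u'.

Lemma Cmod_shift (c z : C) : Cmod z <= Cmod c + Cmod (z - c).
Proof.
replace z with (c + (z - c))%C at 1 by ring. apply Cmod_triangle.
Qed.

(** A power series is differentiable term by term: the bound of [psum_taylor] is
    uniform in the order of the partial sum, so it passes to the limit. *)
Lemma expands_holomorphic (a : nat -> C) (f : C -> C) :
  expands_on_disk a f -> holomorphic f.
Proof.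
intros Ha.
assert (S0 : forall z, Cmod z < 1 -> clim (psum a z) (f z)).
{ intros z Hz. now apply is_pseries_clim, Ha. }
assert (S1 : forall z, Cmod z < 1 -> exists l, clim (psum (dcoef a) z) l).
{ intros z Hz. apply psum_ex_lim.
  assert (Hr : 0 <= Cmod z < 1) by (split; [apply Cmod_ge_0 | exact Hz]).
  assert (H := expands_CV_radius a f (Cmod z) Ha Hr).
  rewrite <- CV_radius_derive in H.
  apply CV_radius_inside, ex_pseries_R in H.
  revert H; apply ex_series_ext; intros k. now rewrite Cmod_dcoef. }
(* Off the disk, where the derived series may diverge, the chosen value is irrelevant. *)
exists (fun z => epsilon (inhabits (RtoC 0)) (clim (psum (dcoef a) z))).
intros c Hc.
assert (Hrho : 0 <= (1 + Cmod c) / 2 < 1) by (assert (H := Cmod_ge_0 c); lra).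
set (rho := (1 + Cmod c) / 2) in *.
assert (H := expands_CV_radius a f rho Ha Hrho).
rewrite <- CV_radius_derive, <- CV_radius_derive in H.
apply CV_radius_inside, ex_pseries_R in H.
destruct H as [K HK].
assert (Hpos : forall k, 0 <= PS_derive (PS_derive (fun k => Cmod (a k))) k * rho ^ k).
{ intros k; unfold PS_derive.
  repeat apply Rmult_le_pos; try apply pos_INR; try apply Cmod_ge_0.
  apply pow_le; lra. }
assert (HN : forall N, sum_n (fun k => PS_derive (PS_derive (fun k => Cmod (a k))) k * rho ^ k) N <= K).
{ intros N. apply (is_lim_seq_incr_compare _ K HK).
  intros n; rewrite sum_Sn. specialize (Hpos (S n)).
  match goal with |- ?u <= plus ?u ?v => change (u <= u + v) end. lra. }
exists ((1 - Cmod c) / 2), K. split; [lra|]. split.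
{ eapply Rle_trans; [|apply (HN O)]. rewrite sum_O; apply Hpos. }
intros z w Hz Hw.
assert (Hz' : Cmod z <= rho) by (assert (H := Cmod_shift c z); unfold rho; lra).
assert (Hw' : Cmod w <= rho) by (assert (H := Cmod_shift c w); unfold rho; lra).
assert (Hz1 : Cmod z < 1) by lra.
assert (Hw1 : Cmod w < 1) by lra.
assert (Hd := epsilon_spec (inhabits (RtoC 0)) _ (S1 z Hz1)).
set (l := epsilon _ _) in *.
assert (L : clim (fun N => psum a w (S (S N)) + (-1) * psum a z (S (S N))
   + (- (w - z)) * psum (dcoef a) z (S N))%C (f w + (-1) * f z + (- (w - z)) * l)%C).
{ apply clim_plus; [apply clim_plus|].
  - apply (clim_incr (fun n => psum a w (S n))), (clim_incr (psum a w)), S0; assumption.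
  - apply clim_scal, (clim_incr (fun n => psum a z (S n))), (clim_incr (psum a z)), S0; assumption.
  - apply clim_scal, (clim_incr (psum (dcoef a) z)), Hd. }
replace (f w - f z - l * (w - z))%C with (f w + (-1) * f z + (- (w - z)) * l)%C by ring.
apply (clim_bound _ _ _ L). intros N.
replace (psum a w (S (S N)) + (-1) * psum a z (S (S N)) + (- (w - z)) * psum (dcoef a) z (S N))%C
  with (psum a w (S (S N)) - psum a z (S (S N)) - psum (dcoef a) z (S N) * (w - z))%C by ring.
eapply Rle_trans; [apply (psum_taylor a z w rho N Hz' Hw')|].
apply Rmult_le_compat_r; [apply pow2_ge_0 | apply HN].
Qed.

(** The local Lipschitz and boundedness estimates contained in [hol], with one
    constant for all of them. *)
Lemma hol_local (u u' : C -> C) (c : C) : hol u u' -> Cmod c < 1 ->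
  exists delta L : R, 0 < delta <= 1 /\ 0 <= L /\
  forall z w : C, Cmod (z - c) < delta -> Cmod (w - c) < delta ->
    Cmod (u w - u z) <= L * Cmod (w - z) /\
    Cmod (u' w - u' z) <= L * Cmod (w - z) /\
    Cmod (u z) <= L /\ Cmod (u' z) <= L /\
    Cmod (u w - u z - u' z * (w - z)) <= L * Cmod (w - z) ^ 2.
Proof.
intros H Hc. destruct (H c Hc) as (d & K & Hd & HK & E).
assert (D : forall z w : C, Cmod (z - c) < d -> Cmod (w - c) < d ->
    Cmod (u' w - u' z) <= 2 * K * Cmod (w - z)).
{ intros z w Hz Hw.
  (* Adding the estimates based at [z] and at [w] leaves [(u' w - u' z) (w - z)]. *)
  destruct (Ceq_dec w z) as [->|N].
  { replace (u' z - u' z)%C with (RtoC 0) by ring. replace (z - z)%C with (RtoC 0) by ring.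
    rewrite Cmod_0; lra. }
  assert (Hp : 0 < Cmod (w - z)) by (apply Cmod_gt_0; now apply Cminus_eq_contra).
  assert (E1 := E z w Hz Hw). assert (E2 := E w z Hw Hz).
  replace (z - w)%C with (- (w - z))%C in E2 by ring. rewrite Cmod_opp in E2.
  assert (E3 := Cmod_triangle (u w - u z - u' z * (w - z)) (u z - u w - u' w * (- (w - z)))).
  replace (u w - u z - u' z * (w - z) + (u z - u w - u' w * (- (w - z))))%C
    with ((u' w - u' z) * (w - z))%C in E3 by ring.
  rewrite Cmod_mult in E3. nra. }
assert (Hc0 : Cmod (c - c) < Rmin d 1).
{ replace (c - c)%C with (RtoC 0) by ring. rewrite Cmod_0. apply Rmin_pos; lra. }
(* [B] bounds [u'] on the ball of radius [Rmin d 1], by its Lipschitz constant [2 K]. *)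
set (B := Cmod (u' c) + 2 * K).
assert (HB : forall z, Cmod (z - c) < Rmin d 1 -> Cmod (u' z) <= B).
{ intros z Hz. assert (H1 := Rmin_l d 1). assert (H2 := Rmin_r d 1).
  assert (H3 := D c z ltac:(lra) ltac:(lra)).
  assert (H4 := Cmod_shift (u' c) (u' z)). unfold B.
  assert (H5 : 2 * K * Cmod (z - c) <= 2 * K * 1) by (apply Rmult_le_compat_l; lra). lra. }
assert (HB0 : 0 <= B) by (unfold B; assert (H1 := Cmod_ge_0 (u' c)); lra).
assert (HL : forall z w, Cmod (z - c) < Rmin d 1 -> Cmod (w - c) < Rmin d 1 ->
  Cmod (u w - u z) <= (2 * K + B) * Cmod (w - z)).
{ intros z w Hz Hw. assert (H1 := Rmin_l d 1). assert (H2 := Rmin_r d 1).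
  assert (E1 := E z w ltac:(lra) ltac:(lra)).
  assert (H3 := Cmod_shift (u' z * (w - z)) (u w - u z)).
  rewrite Cmod_mult in H3. specialize (HB z Hz).
  assert (H4 : Cmod (w - z) <= 2).
  { replace (w - z)%C with ((w - c) + - (z - c))%C by ring.
    eapply Rle_trans; [apply Cmod_triangle|]. rewrite Cmod_opp. lra. }
  assert (H5 := Cmod_ge_0 (w - z)).
  assert (H6 : Cmod (w - z) ^ 2 <= 2 * Cmod (w - z)) by nra.
  assert (H7 := Rmult_le_compat_l _ _ _ HK H6). nra. }
exists (Rmin d 1), (2 * K + B + Cmod (u c)).
assert (H0 := Cmod_ge_0 (u c)).
split; [split; [apply Rmin_pos; lra | apply Rmin_r]|]. split; [lra|].
intros z w Hz Hw.
assert (H1 := Rmin_l d 1). assert (H2 := Rmin_r d 1).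
assert (H5 := Cmod_ge_0 (w - z)).
repeat split.
- specialize (HL z w Hz Hw). nra.
- specialize (D z w ltac:(lra) ltac:(lra)). nra.
- assert (H3 := HL c z Hc0 Hz). assert (H4 := Cmod_shift (u c) (u z)).
  assert (H6 : (2 * K + B) * Cmod (z - c) <= (2 * K + B) * 1) by (apply Rmult_le_compat_l; lra). lra.
- specialize (HB z Hz). lra.
- assert (E1 := E z w ltac:(lra) ltac:(lra)). assert (H6 := pow2_ge_0 (Cmod (w - z))). nra.
Qed.

Lemma holomorphic_const (k : C) : holomorphic (fun _ => k).
Proof.
exists (fun _ => RtoC 0). intros c _. exists 1, 0. repeat split; try lra.
intros z w _ _. replace (k - k - 0 * (w - z))%C with (RtoC 0) by ring.
rewrite Cmod_0; lra.
Qed.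

Lemma holomorphic_id : holomorphic (fun z => z).
Proof.
exists (fun _ => RtoC 1). intros c _. exists 1, 0. repeat split; try lra.
intros z w _ _. replace (w - z - 1 * (w - z))%C with (RtoC 0) by ring.
rewrite Cmod_0; lra.
Qed.

Lemma holomorphic_plus (u v : C -> C) :
  holomorphic u -> holomorphic v -> holomorphic (fun z => u z + v z)%C.
Proof.
intros [u' Hu] [v' Hv]. exists (fun z => u' z + v' z)%C. intros c Hc.
destruct (Hu c Hc) as (d1 & K1 & Hd1 & HK1 & E1).
destruct (Hv c Hc) as (d2 & K2 & Hd2 & HK2 & E2).
exists (Rmin d1 d2), (K1 + K2).
split; [now apply Rmin_pos|]. split; [lra|]. intros z w Hz Hw.
assert (H1 := Rmin_l d1 d2). assert (H2 := Rmin_r d1 d2).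
specialize (E1 z w ltac:(lra) ltac:(lra)). specialize (E2 z w ltac:(lra) ltac:(lra)).
replace (u w + v w - (u z + v z) - (u' z + v' z) * (w - z))%C
 with ((u w - u z - u' z * (w - z)) + (v w - v z - v' z * (w - z)))%C by ring.
eapply Rle_trans; [apply Cmod_triangle|]. lra.
Qed.

Lemma holomorphic_mult (u v : C -> C) :
  holomorphic u -> holomorphic v -> holomorphic (fun z => u z * v z)%C.
Proof.
intros [u' Hu] [v' Hv]. exists (fun z => u' z * v z + u z * v' z)%C. intros c Hc.
destruct (hol_local u u' c Hu Hc) as (d1 & K1 & Hd1 & HK1 & E1).
destruct (hol_local v v' c Hv Hc) as (d2 & K2 & Hd2 & HK2 & E2).
exists (Rmin d1 d2), (3 * K1 * K2).
split; [now apply Rmin_pos|]. split; [nra|]. intros z w Hz Hw.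
assert (H1 := Rmin_l d1 d2). assert (H2 := Rmin_r d1 d2).
destruct (E1 z w ltac:(lra) ltac:(lra)) as (A1 & _ & _ & _ & A2).
destruct (E1 w z ltac:(lra) ltac:(lra)) as (_ & _ & A3 & _).
destruct (E2 z w ltac:(lra) ltac:(lra)) as (B1 & _ & B2 & B3 & B4).
replace (u w * v w - u z * v z - (u' z * v z + u z * v' z) * (w - z))%C
 with (v z * (u w - u z - u' z * (w - z)) + u w * (v w - v z - v' z * (w - z))
       + (u w - u z) * v' z * (w - z))%C by ring.
eapply Rle_trans; [apply Cmod_triangle|].
eapply Rle_trans; [apply Rplus_le_compat_r, Cmod_triangle|].
rewrite !Cmod_mult.
assert (C1 := Rmult_le_compat _ _ _ _ (Cmod_ge_0 _) (Cmod_ge_0 _) B2 A2).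
assert (C2 := Rmult_le_compat _ _ _ _ (Cmod_ge_0 _) (Cmod_ge_0 _) A3 B4).
assert (C3 := Rmult_le_compat_r _ _ _ (Cmod_ge_0 (w - z))
   (Rmult_le_compat _ _ _ _ (Cmod_ge_0 _) (Cmod_ge_0 _) A1 B3)).
nra.
Qed.

Lemma holomorphic_inv (u : C -> C) :
  holomorphic u -> (forall z, Cmod z < 1 -> u z <> RtoC 0) ->
  holomorphic (fun z => / u z)%C.
Proof.
intros [u' Hu] Hnz. exists (fun z => - (u' z / (u z * u z)))%C. intros c Hc.
destruct (hol_local u u' c Hu Hc) as (d & K & Hd & HK & E).
assert (Hm : 0 < Cmod (u c)) by now apply Cmod_gt_0, Hnz.
set (m := Cmod (u c) / 2).
assert (Hm0 : 0 < m) by (unfold m; lra).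
(* On the ball of radius [m / (K + 1)], [u] differs from [u c] by at most [m = |u c| / 2]. *)
set (e := Rmin d (m / (K + 1))).
assert (He1 : e <= d) by apply Rmin_l.
assert (He2 : e <= m / (K + 1)) by apply Rmin_r.
assert (He : 0 < e) by (apply Rmin_pos; [lra | apply Rdiv_lt_0_compat; lra]).
assert (Hlow : forall z, Cmod (z - c) < e -> m <= Cmod (u z)).
{ intros z Hz.
  assert (Hcc : Cmod (c - c) < d).
  { replace (c - c)%C with (RtoC 0) by ring. rewrite Cmod_0. lra. }
  destruct (E z c ltac:(lra) Hcc) as (A & _).
  assert (A2 := Cmod_shift (u z) (u c)).
  replace (c - z)%C with (- (z - c))%C in A by ring. rewrite Cmod_opp in A.
  assert (A3 : (K + 1) * Cmod (z - c) <= m).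
  { replace m with ((K + 1) * (m / (K + 1))) by (field; lra).
    apply Rmult_le_compat_l; lra. }
  assert (A4 := Cmod_ge_0 (z - c)). unfold m in *. nra. }
exists e, (2 * K * K / (m * m * m)).
split; [exact He|].
split; [apply Rmult_le_pos; [nra | left; apply Rinv_0_lt_compat; repeat apply Rmult_lt_0_compat; lra]|].
intros z w Hz Hw.
assert (Lz := Hlow z Hz). assert (Lw := Hlow w Hw).
assert (Nz : u z <> RtoC 0) by (apply Cmod_gt_0; lra).
assert (Nw : u w <> RtoC 0) by (apply Cmod_gt_0; lra).
destruct (E z w ltac:(lra) ltac:(lra)) as (A1 & _ & A2 & A3 & A4).
replace (/ u w - / u z - - (u' z / (u z * u z)) * (w - z))%C
 with ((- u z * (u w - u z - u' z * (w - z)) + u' z * (u w - u z) * (w - z))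
   / (u z * u z * u w))%C by (field; auto).
rewrite Cmod_div by (repeat apply Cmult_neq_0; assumption).
assert (N : Cmod (- u z * (u w - u z - u' z * (w - z)) + u' z * (u w - u z) * (w - z))
  <= 2 * K * K * Cmod (w - z) ^ 2).
{ eapply Rle_trans; [apply Cmod_triangle|].
  rewrite !Cmod_mult, Cmod_opp.
  assert (C1 := Rmult_le_compat _ _ _ _ (Cmod_ge_0 _) (Cmod_ge_0 _) A2 A4).
  assert (C3 := Rmult_le_compat_r _ _ _ (Cmod_ge_0 (w - z))
   (Rmult_le_compat _ _ _ _ (Cmod_ge_0 _) (Cmod_ge_0 _) A3 A1)).
  nra. }
replace (2 * K * K / (m * m * m) * Cmod (w - z) ^ 2)
  with (2 * K * K * Cmod (w - z) ^ 2 * / (m * m * m)) by (unfold Rdiv; ring).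
apply Rmult_le_compat; [apply Cmod_ge_0 | | exact N |].
- left; apply Rinv_0_lt_compat, Cmod_gt_0; repeat apply Cmult_neq_0; assumption.
- apply Rinv_le_contravar; [repeat apply Rmult_lt_0_compat; lra|].
  rewrite !Cmod_mult.
  repeat apply Rmult_le_compat; try lra; try nra.
Qed.

(** * The mean value property on circles *)

(** The point [r e ^ (i theta)]. *)
Definition circ (r theta : R) : C := (r * cos theta, r * sin theta).

Lemma Cmod_circ (r theta : R) : 0 <= r -> Cmod (circ r theta) = r.
Proof.
intros Hr. unfold Cmod, circ; simpl fst; simpl snd.
replace ((r * cos theta) ^ 2 + (r * sin theta) ^ 2) with (r ^ 2).
- now apply sqrt_pow2.
- assert (H := sin2_cos2 theta). unfold Rsqr in H.
  replace ((r * cos theta) ^ 2 + (r * sin theta) ^ 2)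
    with (r ^ 2 * (sin theta * sin theta + cos theta * cos theta)) by ring.
  rewrite H; ring.
Qed.

Lemma Cmod_circ_lt (r theta : R) : Rabs r < 1 -> Cmod (circ r theta) < 1.
Proof.
intros Hr.
replace (circ r theta) with (RtoC r * circ 1 theta)%C.
- rewrite Cmod_mult, Cmod_R, (Cmod_circ 1) by lra. lra.
- unfold circ, RtoC, Cmult; simpl; f_equal; ring.
Qed.

Lemma Cmod_le_Rmax (x y : R) : Cmod (x, y) <= 2 * Rmax (Rabs x) (Rabs y).
Proof.
eapply Rle_trans; [apply Cmod_2Rmax|]. simpl.
apply Rmult_le_compat_r.
- eapply Rle_trans; [apply Rabs_pos | apply Rmax_l].
- left; apply sqrt_less; lra.
Qed.

Lemma im_le_Cmod (c : C) : Rabs (Im c) <= Cmod c.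
Proof. eapply Rle_trans; [apply Rmax_r | apply Rmax_Cmod]. Qed.

(** A function that is locally Lipschitz at an interior point is continuous there
    as a function of the two real coordinates. *)
Lemma Lipschitz_continuity_2d (u : C -> C) (x y delta L : R) :
  0 < delta -> 0 <= L ->
  (forall w : C, Cmod (w - (x, y)) < delta -> Cmod (u w - u (x, y)) <= L * Cmod (w - (x, y))) ->
  continuity_2d_pt (fun x y => Re (u (x, y))) x y /\
  continuity_2d_pt (fun x y => Im (u (x, y))) x y.
Proof.
intros Hd HL H.
assert (E : forall eps : posreal, locally_2d (fun x' y' => Cmod (u (x', y') - u (x, y)) < eps) x y).
{ intros eps.
  assert (He : 0 < Rmin (delta / 2) (eps / (2 * (L + 1)))).
  { assert (H0 := cond_pos eps). apply Rmin_pos; [lra | apply Rdiv_lt_0_compat; lra]. }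
  exists (mkposreal _ He); simpl; intros x' y' Hx Hy.
  assert (M1 := Rmin_l (delta / 2) (eps / (2 * (L + 1)))).
  assert (M2 := Rmin_r (delta / 2) (eps / (2 * (L + 1)))).
  assert (Hm : Cmod ((x', y') - (x, y)) <= 2 * Rmax (Rabs (x' - x)) (Rabs (y' - y)))
    by exact (Cmod_le_Rmax (x' - x) (y' - y)).
  assert (HR := Rmax_lub_lt _ _ _ Hx Hy).
  assert (Hw := H (x', y') ltac:(lra)).
  eapply Rle_lt_trans; [exact Hw|].
  assert (L * Cmod ((x', y') - (x, y)) <= L * (eps / (L + 1))).
  { apply Rmult_le_compat_l; [exact HL|].
    replace (eps / (L + 1)) with (2 * (eps / (2 * (L + 1)))) by (field; lra). lra. }
  apply Rle_lt_trans with (1 := H0).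
  apply Rlt_le_trans with ((L + 1) * (eps / (L + 1))).
  - apply Rmult_lt_compat_r; [|lra]. apply Rdiv_lt_0_compat; [apply cond_pos | lra].
  - right; field; lra. }
split; intros eps; destruct (E eps) as [d Hd']; exists d; intros x' y' Hx Hy;
  eapply Rle_lt_trans; [| apply (Hd' x' y' Hx Hy) | | apply (Hd' x' y' Hx Hy)].
- exact (re_le_Cmod (u (x', y') - u (x, y))).
- exact (im_le_Cmod (u (x', y') - u (x, y))).
Qed.

Lemma hol_continuity_2d (u u' : C -> C) (x y : R) : hol u u' -> Cmod (x, y) < 1 ->
  (continuity_2d_pt (fun x y => Re (u (x, y))) x y /\
   continuity_2d_pt (fun x y => Im (u (x, y))) x y) /\
  (continuity_2d_pt (fun x y => Re (u' (x, y))) x y /\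
   continuity_2d_pt (fun x y => Im (u' (x, y))) x y).
Proof.
intros H Hc. destruct (hol_local u u' (x, y) H Hc) as (d & L & Hd & HL & E).
assert (H0 : Cmod ((x, y) - (x, y)) < d).
{ replace ((x, y) - (x, y))%C with (RtoC 0) by ring. rewrite Cmod_0; lra. }
split; apply (Lipschitz_continuity_2d _ x y d L); try lra; intros w Hw;
  destruct (E (x, y) w H0 Hw) as (A1 & A2 & _); assumption.
Qed.

(** The partial derivatives of [Re u] and [Im u], in Cauchy-Riemann form. *)
Lemma hol_differentiable (u u' : C -> C) (x y : R) : hol u u' -> Cmod (x, y) < 1 ->
  differentiable_pt_lim (fun x y => Re (u (x, y))) x y (Re (u' (x, y))) (- Im (u' (x, y))) /\
  differentiable_pt_lim (fun x y => Im (u (x, y))) x y (Im (u' (x, y))) (Re (u' (x, y))).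
Proof.
intros H Hc. destruct (H (x, y) Hc) as (d & K & Hd & HK & E).
assert (H0 : Cmod ((x, y) - (x, y)) < d).
{ replace ((x, y) - (x, y))%C with (RtoC 0) by ring. rewrite Cmod_0; lra. }
assert (B : forall eps : posreal, locally_2d (fun x' y' =>
  Cmod (u (x', y') - u (x, y) - u' (x, y) * ((x', y') - (x, y)))
   <= eps * Rmax (Rabs (x' - x)) (Rabs (y' - y))) x y).
{ intros eps.
  assert (He : 0 < Rmin (d / 2) (eps / (4 * (K + 1)))).
  { assert (H1 := cond_pos eps). apply Rmin_pos; [lra | apply Rdiv_lt_0_compat; lra]. }
  exists (mkposreal _ He); simpl; intros x' y' Hx Hy.
  assert (M1 := Rmin_l (d / 2) (eps / (4 * (K + 1)))).
  assert (M2 := Rmin_r (d / 2) (eps / (4 * (K + 1)))).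
  assert (Hm : Cmod ((x', y') - (x, y)) <= 2 * Rmax (Rabs (x' - x)) (Rabs (y' - y)))
    by exact (Cmod_le_Rmax (x' - x) (y' - y)).
  assert (HR := Rmax_lub_lt _ _ _ Hx Hy).
  set (rho := Rmax _ _) in *.
  assert (Hrho : 0 <= rho) by (eapply Rle_trans; [apply Rabs_pos | apply Rmax_l]).
  assert (Hw : Cmod ((x', y') - (x, y)) < d) by lra.
  specialize (E (x, y) (x', y') H0 Hw).
  eapply Rle_trans; [exact E|].
  apply Rle_trans with (K * (4 * rho * rho)).
  - apply Rmult_le_compat_l; [exact HK|].
    assert (H2 := Cmod_ge_0 ((x', y') - (x, y))). nra.
  - apply Rle_trans with (4 * (K + 1) * (eps / (4 * (K + 1))) * rho).
    + assert (H3 : rho <= eps / (4 * (K + 1))) by lra.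
      assert (H4 : 4 * (K + 1) * rho <= 4 * (K + 1) * (eps / (4 * (K + 1))))
        by (apply Rmult_le_compat_l; lra).
      assert (H5 := Rmult_le_compat_r _ _ _ Hrho H4). nra.
    + right; field; lra. }
split; intros eps; destruct (B eps) as [e He]; exists e; intros x' y' Hx Hy;
  (eapply Rle_trans; [| apply (He x' y' Hx Hy)]).
- eapply Rle_trans; [|apply re_le_Cmod]. right; f_equal.
  destruct (u (x', y')), (u (x, y)), (u' (x, y)). unfold Re, Im; simpl; ring.
- eapply Rle_trans; [|apply im_le_Cmod]. right; f_equal.
  destruct (u (x', y')), (u (x, y)), (u' (x, y)). unfold Re, Im; simpl; ring.
Qed.

Lemma continuity_2d_circ (g : R -> R -> R) (t theta : R) :
  continuity_2d_pt g (t * cos theta) (t * sin theta) ->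
  continuity_2d_pt (fun t theta => g (t * cos theta) (t * sin theta)) t theta.
Proof.
intros H.
assert (Cc : continuity_2d_pt (fun t theta => t * cos theta) t theta).
{ apply continuity_2d_pt_mult; [apply continuity_2d_pt_id1|].
  apply (continuity_1d_2d_pt_comp cos (fun _ v => v)); [apply continuity_cos | apply continuity_2d_pt_id2]. }
assert (Cs : continuity_2d_pt (fun t theta => t * sin theta) t theta).
{ apply continuity_2d_pt_mult; [apply continuity_2d_pt_id1|].
  apply (continuity_1d_2d_pt_comp sin (fun _ v => v)); [apply continuity_sin | apply continuity_2d_pt_id2]. }
apply continuity_2d_pt_filterlim in H, Cc, Cs. apply continuity_2d_pt_filterlim.
exact (continuous_comp_2 (fun z : R * R => fst z * cos (snd z)) (fun z : R * R => fst z * sin (snd z))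
  g (t, theta) Cc Cs H).
Qed.

(** A jointly continuous function is continuous in its second argument. *)
Lemma continuity_2d_continuous_r (g : R -> R -> R) (x y : R) :
  continuity_2d_pt g x y -> continuous (g x) y.
Proof.
intros H. apply continuity_2d_pt_filterlim in H.
apply (continuous_comp_2 (fun _ : R => x) (fun v : R => v) g y);
  [apply continuous_const | apply continuous_id | exact H].
Qed.

Lemma ball_Rabs_lt_1 (x : R) : Rabs x < 1 -> locally x (fun y => Rabs y < 1).
Proof.
intros Hx. assert (He : 0 < 1 - Rabs x) by lra.
exists (mkposreal _ He). intros y Hy.
assert (Hy' : Rabs (y - x) < 1 - Rabs x) by exact Hy.
assert (H := Rabs_triang_inv y x). lra.
Qed.

Lemma holomorphic_ex_RInt (u : C -> C) (t : R) : holomorphic u -> Rabs t < 1 ->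
  ex_RInt (fun theta => Re (u (circ t theta))) 0 (2 * PI) /\
  ex_RInt (fun theta => Cmod (u (circ t theta)) ^ 2) 0 (2 * PI).
Proof.
intros [u' H] Ht.
assert (Hc : forall theta,
   continuous (fun theta => Re (u (circ t theta))) theta /\
   continuous (fun theta => Im (u (circ t theta))) theta).
{ intros theta.
  destruct (hol_continuity_2d u u' (t * cos theta) (t * sin theta) H (Cmod_circ_lt t theta Ht))
    as [[A1 A2] _].
  split; [exact (continuity_2d_continuous_r _ _ _ (continuity_2d_circ _ t theta A1))
        | exact (continuity_2d_continuous_r _ _ _ (continuity_2d_circ _ t theta A2))]. }
split; apply (ex_RInt_continuous (V := R_CompleteNormedModule)); intros theta _; destruct (Hc theta) as [A1 A2]; [exact A1|].
apply continuous_ext with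
  (fun theta => Re (u (circ t theta)) * Re (u (circ t theta))
              + Im (u (circ t theta)) * Im (u (circ t theta))).
- intros s. rewrite Cmod2_alt. simpl; ring.
- apply (continuous_plus (V := R_NormedModule));
  apply (continuous_mult (K := R_AbsRing)); assumption.
Qed.

(** The derivative of [Re u] along the ray of argument [theta]. *)
Definition ray_deriv (u' : C -> C) (t theta : R) : R :=
  Re (u' (circ t theta)) * cos theta - Im (u' (circ t theta)) * sin theta.

Lemma is_derive_ray (u u' : C -> C) (t theta : R) : hol u u' -> Rabs t < 1 ->
  is_derive (fun t => Re (u (circ t theta))) t (ray_deriv u' t theta).
Proof.
intros H Ht.
destruct (hol_differentiable u u' _ _ H (Cmod_circ_lt t theta Ht)) as [D _].
apply is_derive_Reals. unfold ray_deriv, Rminus. rewrite <- Ropp_mult_distr_l_reverse.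
apply (derivable_pt_lim_comp_2d _ (fun t => t * cos theta) (fun t => t * sin theta) t _ _ _ _ D);
  apply is_derive_Reals; auto_derive; auto; ring.
Qed.

(** By the Cauchy-Riemann equations the angular derivative of [Im u] is [t] times
    the radial derivative of [Re u]. *)
Lemma is_derive_angle (u u' : C -> C) (t theta : R) : hol u u' -> Rabs t < 1 ->
  is_derive (fun theta => Im (u (circ t theta))) theta (t * ray_deriv u' t theta).
Proof.
intros H Ht.
destruct (hol_differentiable u u' _ _ H (Cmod_circ_lt t theta Ht)) as [_ D].
apply is_derive_Reals.
replace (t * ray_deriv u' t theta) with
  (Im (u' (circ t theta)) * (- (t * sin theta)) + Re (u' (circ t theta)) * (t * cos theta))
  by (unfold ray_deriv; ring).
apply (derivable_pt_lim_comp_2d _ (fun theta => t * cos theta) (fun theta => t * sin theta) theta _ _ _ _ D);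
  apply is_derive_Reals; auto_derive; auto; ring.
Qed.

Lemma ray_deriv_continuity_2d (u u' : C -> C) (t theta : R) : hol u u' -> Rabs t < 1 ->
  continuity_2d_pt (ray_deriv u') t theta.
Proof.
intros H Ht.
destruct (hol_continuity_2d u u' _ _ H (Cmod_circ_lt t theta Ht)) as [_ [A1 A2]].
apply continuity_2d_pt_minus; apply continuity_2d_pt_mult.
- exact (continuity_2d_circ _ t theta A1).
- apply (continuity_1d_2d_pt_comp cos (fun _ v => v)); [apply continuity_cos | apply continuity_2d_pt_id2].
- exact (continuity_2d_circ _ t theta A2).
- apply (continuity_1d_2d_pt_comp sin (fun _ v => v)); [apply continuity_sin | apply continuity_2d_pt_id2].
Qed.

(** Differentiation under the integral sign. *)
Lemma is_derive_circle_integral (u u' : C -> C) (t : R) : hol u u' -> Rabs t < 1 ->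
  is_derive (fun t => RInt (fun theta => Re (u (circ t theta))) 0 (2 * PI)) t
    (RInt (ray_deriv u' t) 0 (2 * PI)).
Proof.
intros H Ht.
rewrite (RInt_ext (ray_deriv u' t) (fun theta => Derive (fun t => Re (u (circ t theta))) t)).
2:{ intros theta _. symmetry. now apply is_derive_unique, is_derive_ray. }
apply (is_derive_RInt_param (fun t theta => Re (u (circ t theta)))).

- generalize (ball_Rabs_lt_1 t Ht). apply filter_imp; intros s Hs theta _.
  exists (ray_deriv u' s theta). now apply is_derive_ray.
-  intros theta _.
  apply continuity_2d_pt_ext_loc with (ray_deriv u'); [|now apply (ray_deriv_continuity_2d u)].
  destruct (ball_Rabs_lt_1 t Ht) as [e He]. exists e. intros s phi Hs _.
  symmetry. apply is_derive_unique, is_derive_ray; [exact H | now apply He].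
-  generalize (ball_Rabs_lt_1 t Ht). apply filter_imp; intros s Hs.
  exact (proj1 (holomorphic_ex_RInt u s (ex_intro _ u' H) Hs)).
Qed.

(** [t] times the integrand is the derivative of a [2 pi]-periodic function. *)
Lemma RInt_ray_deriv (u u' : C -> C) (t : R) : hol u u' -> Rabs t < 1 -> t <> 0 ->
  RInt (ray_deriv u' t) 0 (2 * PI) = 0.
Proof.
intros H Ht Hnz.
assert (Cn : forall theta, continuous (ray_deriv u' t) theta).
{ intros theta. apply continuity_2d_continuous_r.
  now apply (ray_deriv_continuity_2d u). }
assert (D : is_RInt (fun theta => t * ray_deriv u' t theta) 0 (2 * PI)
  (minus (Im (u (circ t (2 * PI)))) (Im (u (circ t 0))))).
{ apply (is_RInt_derive (fun theta => Im (u (circ t theta)))).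
  - intros theta _. apply is_derive_angle; assumption.
  - intros theta _. apply (continuous_mult (K := R_AbsRing)); [apply continuous_const | apply Cn]. }
apply (is_RInt_unique (V := R_CompleteNormedModule)) in D.
assert (E : RInt (fun theta => t * ray_deriv u' t theta) 0 (2 * PI)
   = t * RInt (ray_deriv u' t) 0 (2 * PI)).
{ apply (RInt_scal (V := R_CompleteNormedModule)), (ex_RInt_continuous (V := R_CompleteNormedModule)).
  intros; apply Cn. }
rewrite E in D.
replace (circ t (2 * PI)) with (circ t 0) in D
  by (unfold circ; now rewrite cos_2PI, sin_2PI, cos_0, sin_0).
rewrite minus_eq_zero in D. change (t * RInt (ray_deriv u' t) 0 (2 * PI) = 0) in D.
destruct (Rmult_integral _ _ D); [contradiction | assumption].
Qed.

(** The mean value property: the circle integral has zero derivative in the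
    radius, and at radius 0 it is [2 pi Re (u 0)]. *)
Lemma holomorphic_mean_value (u : C -> C) (r : R) : holomorphic u -> 0 < r < 1 ->
  RInt (fun theta => Re (u (circ r theta))) 0 (2 * PI) = 2 * PI * Re (u 0).
Proof.
intros [u' H] Hr.
destruct (MVT_gen (fun t => RInt (fun theta => Re (u (circ t theta))) 0 (2 * PI)) 0 r (fun _ => 0))
  as [c [_ E]].
- rewrite Rmin_left, Rmax_right by lra. intros t Ht.
  assert (Ht' : Rabs t < 1) by (rewrite Rabs_pos_eq; lra).
  assert (D := is_derive_circle_integral u u' t H Ht').
  rewrite (RInt_ray_deriv u u' t H Ht') in D by lra. exact D.
- rewrite Rmin_left, Rmax_right by lra. intros t Ht.
  assert (Ht' : Rabs t < 1) by (rewrite Rabs_pos_eq; lra).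
  apply continuity_pt_filterlim.
  refine (ex_derive_continuous (V := R_NormedModule)
    (fun t => RInt (fun theta => Re (u (circ t theta))) 0 (2 * PI)) t _).
  exists (RInt (ray_deriv u' t) 0 (2 * PI)).
  exact (is_derive_circle_integral u u' t H Ht').
- rewrite Rmult_0_l in E. apply Rminus_diag_uniq in E. rewrite E.
  rewrite (RInt_ext _ (fun _ => Re (u 0))).
  + rewrite RInt_const. unfold scal; simpl; unfold mult; simpl. ring.
  + intros theta _. do 2 f_equal. unfold circ, RtoC. f_equal; ring.
Qed.

(** * Parseval's identity for finite Taylor expansions *)

(** [c 0 + c 1 z + ... + c (n - 1) z ^ (n - 1) + z ^ n psi z], in Horner form. *)
Fixpoint horner (c : nat -> C) (n : nat) (psi : C -> C) (z : C) : C :=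
  match n with
  | O => psi z
  | S m => (c O + z * horner (fun k => c (S k)) m psi z)%C
  end.

(** [|c 0|^2 + |c 1|^2 r ^ 2 + ... + |c (n - 1)|^2 r ^ (2 (n - 1))]. *)
Fixpoint sqsum (c : nat -> C) (n : nat) (r : R) : R :=
  match n with
  | O => 0
  | S m => Cmod (c O) ^ 2 + r ^ 2 * sqsum (fun k => c (S k)) m r
  end.

(** The integral of [|u|^2] over the circle of radius [r], with respect to the
    angle. *)
Definition circle_norm2 (r : R) (u : C -> C) : R :=
  RInt (fun theta => Cmod (u (circ r theta)) ^ 2) 0 (2 * PI).

Lemma horner_holomorphic (c : nat -> C) (n : nat) (psi : C -> C) :
  holomorphic psi -> holomorphic (horner c n psi).
Proof.
intros H. revert c; induction n as [|n IH]; intros c; [exact H|].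
apply (holomorphic_plus (fun _ => c O) (fun z => z * _)%C).
- apply holomorphic_const.
- apply (holomorphic_mult (fun z => z)); [apply holomorphic_id | apply IH].
Qed.

Lemma horner_plus (c : nat -> C) (n : nat) (psi chi : C -> C) (z : C) :
  horner c n (fun z => psi z + chi z)%C z = (horner c n psi z + z ^ n * chi z)%C.
Proof.
revert c; induction n as [|n IH]; intros c; simpl; [ring|].
rewrite IH. ring.
Qed.

(** The cross term [2 Re (conj c * z u z)] integrates to 0 by the mean value
    property. *)
Lemma circle_norm2_step (c : C) (u : C -> C) (r : R) : holomorphic u -> 0 < r < 1 ->
  circle_norm2 r (fun z => c + z * u z)%C
  = 2 * PI * Cmod c ^ 2 + r ^ 2 * circle_norm2 r u.
Proof.
intros Hu Hr.
assert (Hr' : Rabs r < 1) by (rewrite Rabs_pos_eq; lra).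
assert (Hv : holomorphic (fun z => Cconj c * (z * u z))%C).
{ apply (holomorphic_mult (fun _ => Cconj c)); [apply holomorphic_const|].
  apply (holomorphic_mult (fun z => z)); [apply holomorphic_id | exact Hu]. }
assert (E1 := proj1 (holomorphic_ex_RInt _ r Hv Hr')).
assert (E2 := proj2 (holomorphic_ex_RInt _ r Hu Hr')).
assert (M := holomorphic_mean_value _ r Hv Hr).
unfold circle_norm2.
transitivity (RInt (fun theta => plus (plus (Cmod c ^ 2)
   (scal 2 (Re (Cconj c * (circ r theta * u (circ r theta))))))
   (scal (r ^ 2) (Cmod (u (circ r theta)) ^ 2))) 0 (2 * PI)).
- apply RInt_ext; intros theta _.
  change (Cmod (c + circ r theta * u (circ r theta)) ^ 2
   = Cmod c ^ 2 + 2 * Re (Cconj c * (circ r theta * u (circ r theta)))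
     + r ^ 2 * Cmod (u (circ r theta)) ^ 2).
  replace (r ^ 2 * Cmod (u (circ r theta)) ^ 2)
    with (Cmod (circ r theta * u (circ r theta)) ^ 2)
    by (rewrite Cmod_mult, Cmod_circ by lra; ring).
  rewrite !Cmod2_alt.
  destruct c as [c1 c2], (circ r theta * u (circ r theta))%C as [w1 w2].
  unfold Re, Im, Cconj; simpl; ring.
- rewrite (RInt_plus (V := R_CompleteNormedModule)).
  + rewrite (RInt_plus (V := R_CompleteNormedModule)).
    * rewrite RInt_const.
      rewrite (RInt_scal (V := R_CompleteNormedModule)) by exact E1.
      rewrite (RInt_scal (V := R_CompleteNormedModule)) by exact E2.
      rewrite M. unfold plus, scal; simpl; unfold mult; simpl. ring.
    * apply ex_RInt_const.
    * apply (ex_RInt_scal (V := R_NormedModule)). exact E1.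
  + apply (ex_RInt_plus (V := R_NormedModule)); [apply ex_RInt_const|].
    apply (ex_RInt_scal (V := R_NormedModule)). exact E1.
  + apply (ex_RInt_scal (V := R_NormedModule)). exact E2.
Qed.

Lemma parseval (c : nat -> C) (n : nat) (psi : C -> C) (r : R) :
  holomorphic psi -> 0 < r < 1 ->
  circle_norm2 r (horner c n psi) = 2 * PI * sqsum c n r + r ^ (2 * n) * circle_norm2 r psi.
Proof.
intros H Hr. revert c; induction n as [|n IH]; intros c.
- change (horner c 0 psi) with psi. simpl. ring.
- change (horner c (S n) psi) with (fun z => c O + z * horner (fun k => c (S k)) n psi z)%C.
  rewrite circle_norm2_step; [|now apply horner_holomorphic | exact Hr].
  rewrite IH. replace (2 * S n)%nat with (S (S (2 * n))) by lia.
  rewrite <- !tech_pow_Rmult. cbn [sqsum]. ring.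
Qed.

Lemma circle_norm2_pos (u : C -> C) (r : R) : holomorphic u -> 0 < r < 1 ->
  0 <= circle_norm2 r u.
Proof.
intros Hu Hr. apply RInt_ge_0.
- assert (H := PI_RGT_0); lra.
- apply (proj2 (holomorphic_ex_RInt u r Hu ltac:(rewrite Rabs_pos_eq; lra))).
- intros; apply pow2_ge_0.
Qed.

Lemma circle_norm2_zero (r : R) : circle_norm2 r (fun _ => RtoC 0) = 0.
Proof.
unfold circle_norm2. rewrite (RInt_ext _ (fun _ => 0)).
- rewrite RInt_const. unfold scal; simpl; unfold mult; simpl. ring.
- intros; rewrite Cmod_0; simpl; ring.
Qed.

Lemma circle_norm2_le (u v : C -> C) (r : R) : holomorphic u -> holomorphic v -> 0 < r < 1 ->
  (forall z, Cmod z < 1 -> Cmod (u z) <= Cmod (v z)) ->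
  circle_norm2 r u <= circle_norm2 r v.
Proof.
intros Hu Hv Hr H.
assert (Hr' : Rabs r < 1) by (rewrite Rabs_pos_eq; lra).
apply RInt_le.
- assert (HP := PI_RGT_0); lra.
- apply (proj2 (holomorphic_ex_RInt u r Hu Hr')).
- apply (proj2 (holomorphic_ex_RInt v r Hv Hr')).
- intros theta _. apply pow_incr; split; [apply Cmod_ge_0|].
  now apply H, Cmod_circ_lt.
Qed.

Lemma sqsum_ge_0 (c : nat -> C) (n : nat) (r : R) : 0 <= sqsum c n r.
Proof.
revert c; induction n as [|n IH]; intros c; simpl; [lra|].
apply Rplus_le_le_0_compat; [apply (pow2_ge_0 (Cmod (c O)))|].
apply Rmult_le_pos; [apply (pow2_ge_0 r) | apply IH].
Qed.

Lemma sqsum_continuous (c : nat -> C) (n : nat) (r : R) : continuity_pt (sqsum c n) r.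
Proof.
revert c; induction n as [|n IH]; intros c; simpl.
- apply continuity_pt_const. now intros x y.
- apply (continuity_pt_plus (fun _ => _) (fun r => r * (r * 1) * _)).
  + apply continuity_pt_const. now intros x y.
  + apply (continuity_pt_mult (fun r => r * (r * 1)) (fun r => sqsum (fun k => c (S k)) n r));
      [|apply IH].
    reg.
Qed.

Lemma sqsum_1 (c : nat -> C) (n : nat) :
  sqsum c (S n) 1 = sum_n (fun k => Cmod (c k) ^ 2) n.
Proof.
revert c; induction n as [|n IH]; intros c.
- rewrite sum_O. simpl. ring.
- change (Cmod (c O) ^ 2 + 1 ^ 2 * sqsum (fun k => c (S k)) (S n) 1
    = sum_n (fun k => Cmod (c k) ^ 2) (S n)).
  rewrite IH. unfold sum_n. rewrite (sum_Sn_m _ 0 (S n)) by lia.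
  rewrite <- (sum_n_m_S (fun k => Cmod (c k) ^ 2)).
  rewrite pow1, Rmult_1_l. reflexivity.
Qed.

(** * Algebra of power series on the disk *)

Lemma expands_clim (a : nat -> C) (f : C -> C) :
  expands_on_disk a f <-> forall z, Cmod z < 1 -> clim (psum a z) (f z).
Proof.
split; intros H z Hz; apply is_pseries_clim, H, Hz.
Qed.

Lemma expands_ext (a b : nat -> C) (f g : C -> C) :
  (forall k, a k = b k) -> (forall z, Cmod z < 1 -> f z = g z) ->
  expands_on_disk a f -> expands_on_disk b g.
Proof.
intros E1 E2 H z Hz. rewrite <- (E2 z Hz).
apply is_pseries_ext with a; [exact E1 | now apply H].
Qed.

Lemma expands_lin (a b : nat -> C) (f g : C -> C) (s t : C) :
  expands_on_disk a f -> expands_on_disk b g ->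
  expands_on_disk (fun k => s * a k + t * b k)%C (fun z => s * f z + t * g z)%C.
Proof.
rewrite !expands_clim. intros Ha Hb z Hz.
apply clim_ext with (fun N => s * psum a z N + t * psum b z N)%C.
- intros N; induction N as [|N IH]; [reflexivity|]. cbn [psum]. rewrite <- IH. ring.
- apply clim_plus; apply clim_scal; auto.
Qed.

(** The coefficients of [z f(z)]. *)
Definition shift (a : nat -> C) (k : nat) : C :=
  match k with O => RtoC 0 | S j => a j end.

Lemma expands_shift (a : nat -> C) (f : C -> C) :
  expands_on_disk a f -> expands_on_disk (shift a) (fun z => z * f z)%C.
Proof.
rewrite !expands_clim. intros Ha z Hz.
apply (is_lim_seq_incr_1 (fun n => Cmod (psum (shift a) z n - z * f z))).
apply (clim_ext (fun N => z * psum a z N)%C (fun N => psum (shift a) z (S N))).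
- intros N; induction N as [|N IH]; [simpl; ring|].
  change (psum (shift a) z (S (S N))) with (psum (shift a) z (S N) + a (S N) * z ^ S (S N))%C.
  rewrite <- IH. cbn [psum]. rewrite (Cpow_S z (S N)). ring.
- apply clim_scal; auto.
Qed.

(** The coefficients of a constant function. *)
Definition const_coef (c : C) (k : nat) : C :=
  match k with O => c | S _ => RtoC 0 end.

Lemma psum_const (c z : C) (N : nat) : psum (const_coef c) z N = c.
Proof.
induction N as [|N IH]; [reflexivity|].
cbn [psum const_coef]. rewrite IH. ring.
Qed.

Lemma psum_at_0 (a : nat -> C) (N : nat) : psum a 0 N = a O.
Proof.
induction N as [|N IH]; [reflexivity|]. cbn [psum]. rewrite IH, Cpow_S. ring.
Qed.

Lemma clim_const (c : C) : clim (fun _ => c) c.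
Proof.
unfold clim. apply is_lim_seq_ext with (fun _ => 0); [|apply is_lim_seq_const].
intros _. replace (c - c)%C with (RtoC 0) by ring. now rewrite Cmod_0.
Qed.

Lemma expands_const (c : C) : expands_on_disk (const_coef c) (fun _ => c).
Proof.
rewrite expands_clim. intros z _.
apply (clim_ext (fun _ => c)); [|apply clim_const].
intros N; symmetry; apply psum_const.
Qed.

(** Division by [z] after removing the constant term. *)
Lemma expands_tail (a : nat -> C) (f : C -> C) : expands_on_disk a f ->
  exists e, expands_on_disk (fun k => a (S k)) e /\
    forall z, Cmod z < 1 -> f z = (a O + z * e z)%C.
Proof.
rewrite expands_clim. intros Ha.
exists (fun z => if Ceq_dec z 0 then a 1%nat else ((f z - a O) / z)%C). split.
- apply expands_clim. intros z Hz. destruct (Ceq_dec z 0) as [->|N].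
  + apply (clim_ext (fun _ => a 1%nat)); [|apply clim_const].
    intros N; symmetry; apply (psum_at_0 (fun k => a (S k))).
  + apply (clim_ext (fun N => / z * (psum a z (S N) + (-1) * a O))%C).
    * intros N'; induction N' as [|N' IH]; [simpl; field; exact N|].
      change (psum a z (S (S N'))) with (psum a z (S N') + a (S (S N')) * z ^ S (S N'))%C.
      change (psum (fun k => a (S k)) z (S N'))
        with (psum (fun k => a (S k)) z N' + a (S (S N')) * z ^ S N')%C.
      rewrite <- IH. rewrite (Cpow_S z (S N')). field; exact N.
    * replace ((f z - a O) / z)%C with (/ z * (f z + (-1) * a O))%C by (field; exact N).
      apply (clim_scal (/ z) (fun N => psum a z (S N) + (-1) * a O)%C).
      apply clim_plus; [apply (clim_incr (psum a z)); auto | apply clim_const].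
- intros z Hz. destruct (Ceq_dec z 0) as [->|N]; [|field; exact N].
  transitivity (a O); [|ring].
  apply (clim_unique (psum a 0)); [now apply Ha|].
  apply (clim_ext (fun _ => a O)); [|apply clim_const].
  intros N; symmetry; apply psum_at_0.
Qed.

Lemma expands_horner (a : nat -> C) (f : C -> C) (n : nat) : expands_on_disk a f ->
  exists e, holomorphic e /\ forall z, Cmod z < 1 -> f z = horner a n e z.
Proof.
revert a f; induction n as [|n IH]; intros a f Ha.
- exists f; split; [now apply expands_holomorphic with a | reflexivity].
- destruct (expands_tail a f Ha) as (e & He & E).
  destruct (IH _ _ He) as (e' & He' & E').
  exists e'; split; [exact He'|]. intros z Hz. simpl. now rewrite <- E', E.
Qed.

(** The coefficients can be read off from Parseval's identity: if the function
    vanishes then so do all partial sums of [|a k|^2 r ^ (2 k)]. *)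
Lemma expands_zero (a : nat -> C) (f : C -> C) : expands_on_disk a f ->
  (forall z, Cmod z < 1 -> f z = RtoC 0) -> forall k, a k = RtoC 0.
Proof.
intros Ha Hf.
assert (H0 : forall n, sqsum a n (/ 2) = 0).
{ intros n. destruct (expands_horner a f n Ha) as (e & He & E).
  assert (Hr : 0 < / 2 < 1) by lra.
  assert (P := parseval a n e (/ 2) He Hr).
  assert (L := circle_norm2_le (horner a n e) (fun _ => RtoC 0) (/ 2)
    (horner_holomorphic a n e He) (holomorphic_const 0) Hr).
  rewrite circle_norm2_zero in L.
  assert (L' : circle_norm2 (/ 2) (horner a n e) <= 0).
  { apply L. intros z Hz. rewrite <- E, Hf by exact Hz. lra. }
  assert (Q := circle_norm2_pos e (/ 2) He Hr).
  assert (Q' : 0 <= (/ 2) ^ (2 * n) * circle_norm2 (/ 2) e)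
    by (apply Rmult_le_pos; [apply pow_le; lra | exact Q]).
  assert (Hs := sqsum_ge_0 a n (/ 2)). assert (HP := PI_RGT_0).
  nra. }
clear Ha Hf. intros k. revert a H0; induction k as [|k IH]; intros a H0.
- apply Cmod_eq_0. specialize (H0 1%nat). simpl in H0. nra.
- apply (IH (fun k => a (S k))). intros n. specialize (H0 (S n)). simpl in H0.
  assert (Hs := sqsum_ge_0 (fun k => a (S k)) n (/ 2)).
  assert (M := pow2_ge_0 (Cmod (a O))). simpl in M. nra.
Qed.

Lemma expands_unique (a b : nat -> C) (f : C -> C) :
  expands_on_disk a f -> expands_on_disk b f -> forall k, a k = b k.
Proof.
intros Ha Hb k.
assert (H := expands_zero _ _ (expands_lin a b f f 1 (-1) Ha Hb)).
assert (Hk : (1 * a k + (-1) * b k)%C = RtoC 0) by (apply H; intros; ring).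
apply Ceq_minus. rewrite <- Hk. ring.
Qed.

(** * Coefficient comparison for a dominated power series *)

(** The function [phi = T F / G], with [T] the truncation of [G] at order [m],
    satisfies [|phi| <= |T|] and has the same Taylor coefficients as [F] up to
    order [m]. *)
Lemma dominated_sqsum (p q : nat -> C) (F G : C -> C) (m : nat) (r : R) :
  expands_on_disk p F -> expands_on_disk q G -> p O = RtoC 0 ->
  (forall z, Cmod z < 1 -> G z <> RtoC 0 /\ Cmod (F z) <= Cmod (G z)) ->
  0 < r < 1 -> sqsum p (S m) r <= sqsum q m r.
Proof.
intros HF HG Hp0 Hdom Hr.
destruct (expands_horner p F (S m) HF) as (eF & HeF & EF).
destruct (expands_horner q G m HG) as (eG & HeG & EG).
destruct (expands_horner p F 1 HF) as (F1 & HF1 & EF1).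
assert (HGi : holomorphic (fun z => / G z)%C).
{ apply holomorphic_inv; [now apply expands_holomorphic with q|].
  intros z Hz. now apply Hdom. }
set (psi := (fun z => eF z + (-1) * (eG z * (F1 z * / G z)))%C).
assert (Hpsi : holomorphic psi).
{ apply holomorphic_plus; [exact HeF|].
  apply (holomorphic_mult (fun _ => RtoC (-1))); [apply holomorphic_const|].
  apply holomorphic_mult; [exact HeG|]. now apply holomorphic_mult. }
set (T := horner q m (fun _ => RtoC 0)).
assert (HT : holomorphic T) by apply horner_holomorphic, holomorphic_const.
(* [T F / G = F - z ^ m eG F / G], and [F = z F1]. *)
assert (Ephi : forall z, Cmod z < 1 -> horner p (S m) psi z = (T z * F z / G z)%C).
{ intros z Hz. destruct (Hdom z Hz) as [HGz _].
  unfold psi. rewrite horner_plus, <- EF by exact Hz.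
  assert (E1 : F z = (z * F1 z)%C).
  { rewrite (EF1 z Hz). simpl. rewrite Hp0. ring. }
  assert (E2 : G z = (T z + z ^ m * eG z)%C).
  { rewrite (EG z Hz). unfold T. rewrite <- horner_plus.
    clear. revert q; induction m as [|m IH]; intros q; simpl; [ring|]. now rewrite IH. }
  assert (E3 : T z = (G z - z ^ m * eG z)%C) by (rewrite E2; ring).
  rewrite E3, Cpow_S. rewrite E1. field. exact HGz. }
assert (L : circle_norm2 r (horner p (S m) psi) <= circle_norm2 r T).
{ apply circle_norm2_le; [now apply horner_holomorphic | exact HT | exact Hr |].
  intros z Hz. rewrite (Ephi z Hz). destruct (Hdom z Hz) as [HGz Hle].
  rewrite Cmod_div, Cmod_mult by exact HGz.
  assert (HGp : 0 < Cmod (G z)) by now apply Cmod_gt_0.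
  apply Rle_trans with (Cmod (T z) * Cmod (G z) / Cmod (G z)).
  - apply Rmult_le_compat_r; [left; now apply Rinv_0_lt_compat|].
    apply Rmult_le_compat_l; [apply Cmod_ge_0 | exact Hle].
  - right; field; lra. }
unfold T in L. rewrite !parseval in L; try assumption; [|apply holomorphic_const].
rewrite circle_norm2_zero, Rmult_0_r, Rplus_0_r in L.
assert (Q := circle_norm2_pos psi r Hpsi Hr).
assert (Q' : 0 <= r ^ (2 * S m) * circle_norm2 r psi)
  by (apply Rmult_le_pos; [apply pow_le; lra | exact Q]).
assert (HP := PI_RGT_0). nra.
Qed.

(** The limit [r -> 1] of [dominated_sqsum]. *)
Lemma dominated_coefficients (p q : nat -> C) (F G : C -> C) (m : nat) :
  expands_on_disk p F -> expands_on_disk q G -> p O = RtoC 0 ->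
  (forall z, Cmod z < 1 -> G z <> RtoC 0 /\ Cmod (F z) <= Cmod (G z)) ->
  sum_n (fun k => Cmod (p k) ^ 2) (S m) <= sum_n (fun k => Cmod (q k) ^ 2) m.
Proof.
intros HF HG Hp0 Hdom. rewrite <- !sqsum_1.
assert (H := fun r => dominated_sqsum p q F G (S m) r HF HG Hp0 Hdom).
apply Rnot_lt_le; intros Hlt.
assert (C := continuity_pt_minus (sqsum p (S (S m))) (sqsum q (S m)) 1
   (sqsum_continuous _ _ _) (sqsum_continuous _ _ _)).
destruct (C (sqsum p (S (S m)) 1 - sqsum q (S m) 1) ltac:(lra)) as (d & Hd & Hc).
set (r := 1 - Rmin (d / 2) (/ 2)).
assert (M1 := Rmin_l (d / 2) (/ 2)). assert (M2 := Rmin_r (d / 2) (/ 2)).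
assert (M3 : 0 < Rmin (d / 2) (/ 2)) by (apply Rmin_pos; lra).
assert (Hr : 0 < r < 1) by (unfold r; lra).
specialize (H r Hr).
assert (D := Hc r). simpl in D. unfold R_dist, D_x, no_cond, minus_fct in D.
assert (D' := D ltac:(split; [split; [exact I | lra] |
   unfold r; rewrite Rabs_left; lra])).
apply Rabs_def2 in D'. simpl in *. lra.
Qed.

(** * The operator [D_zeta] on Taylor coefficients *)

(** Comparison of coefficients in [(1 - zeta z) (1 - z) K(z) = z]. *)
Lemma kernel_coef (zeta : C) (b : nat -> C) : Cmod zeta <= 1 ->
  expands_on_disk b (kernel zeta) -> forall k, b k = bracket zeta k.
Proof.
intros Hzeta Hb.
assert (H1 := expands_shift _ _ Hb). assert (H2 := expands_shift _ _ H1).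
assert (H3 := expands_lin _ _ _ _ 1 zeta
  (expands_lin _ _ _ _ 1 (- (1 + zeta)) Hb H1) H2).
assert (Hid := expands_shift _ _ (expands_const 1)).
assert (E : forall k, (1 * (1 * b k + - (1 + zeta) * shift b k) + zeta * shift (shift b) k)%C
   = shift (const_coef 1) k).
{ apply (expands_unique _ _ (fun z => z * 1)%C); [|exact Hid].
  revert H3; apply expands_ext; [reflexivity|]. intros z Hz.
  assert (N1 : (1 - z)%C <> RtoC 0).
  { intros E. apply (Rlt_not_le _ _ Hz). replace z with (RtoC 1 - (1 - z))%C by ring.
    rewrite E. replace (1 - 0)%C with (RtoC 1) by ring. rewrite Cmod_1; lra. }
  assert (N2 : (1 - zeta * z)%C <> RtoC 0).
  { intros E. assert (E' : (zeta * z)%C = RtoC 1).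
    { replace (zeta * z)%C with (RtoC 1 - (1 - zeta * z))%C by ring. rewrite E; ring. }
    assert (M : Cmod (zeta * z) = 1) by (rewrite E'; apply Cmod_1).
    rewrite Cmod_mult in M.
    assert (G1 := Cmod_ge_0 z). assert (G2 := Cmod_ge_0 zeta). nra. }
  unfold kernel. field. split; assumption. }
assert (B0 : b O = bracket zeta 0).
{ rewrite <- (E O : _ = bracket zeta 0). simpl. ring. }
assert (B1 : b 1%nat = bracket zeta 1).
{ assert (E1 := E 1%nat). simpl in E1, B0 |- *. rewrite B0 in E1.
  replace (b 1%nat) with (1 * (1 * b 1%nat + - (1 + zeta) * 0) + zeta * 0)%C by ring.
  rewrite E1. ring. }
assert (BB : forall k, b k = bracket zeta k /\ b (S k) = bracket zeta (S k)).
{ intros k; induction k as [|k [IH1 IH2]]; [now split|]. split; [exact IH2|].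
  assert (Ek := E (S (S k))). cbn [shift const_coef] in Ek. rewrite IH1, IH2 in Ek.
  replace (b (S (S k))) with
   (1 * (1 * b (S (S k)) + - (1 + zeta) * bracket zeta (S k)) + zeta * bracket zeta k
     + (1 + zeta) * bracket zeta (S k) - zeta * bracket zeta k)%C by ring.
  rewrite Ek. cbn [bracket]. rewrite Cpow_S. ring. }
intros k; apply BB.
Qed.

(** [Re (h / f) > alpha] says that [h / f] is closer to [1] than to
    [2 alpha - 1]. *)
Lemma half_plane_domination (h f : C) (alpha : R) :
  0 <= alpha < 1 -> alpha < Re (h / f) ->
  (h + RtoC (1 - 2 * alpha) * f)%C <> RtoC 0 /\
  Cmod (h - f) <= Cmod (h + RtoC (1 - 2 * alpha) * f).
Proof.
intros Ha Hq.
assert (Nf : f <> RtoC 0).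
{ (* [h / 0 = 0] by convention, which violates [alpha < Re (h / f)] as [alpha >= 0]. *)
  intros ->. revert Hq. unfold Cdiv, Cinv, Re; simpl. unfold Rdiv. nra. }
assert (Hlt : Cmod (h - f) ^ 2 < Cmod (h + RtoC (1 - 2 * alpha) * f) ^ 2).
{ set (P := (h / f)%C) in *.
  assert (Eh : h = (P * f)%C) by (unfold P; field; exact Nf).
  replace (h - f)%C with ((P - 1) * f)%C by (rewrite Eh; ring).
  replace (h + RtoC (1 - 2 * alpha) * f)%C with ((P + RtoC (1 - 2 * alpha)) * f)%C
    by (rewrite Eh; ring).
  rewrite !Cmod_mult, !Rpow_mult_distr.
  apply Rmult_lt_compat_r; [now apply pow_lt, Cmod_gt_0|].
  rewrite !Cmod2_alt. destruct P as [x y]. unfold Re, Im in *; simpl in *. nra. }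
assert (G1 := Cmod_ge_0 (h - f)).
assert (G2 := Cmod_ge_0 (h + RtoC (1 - 2 * alpha) * f)).
split; [apply Cmod_gt_0|]; nra.
Qed.

Theorem theorem5p1 (zeta : C) (alpha : R) (f : C -> C) (a : nat -> C) (n : nat)
  (Hzeta : Cmod zeta <= 1)
  (Halpha : 0 <= alpha < 1)
  (Hf : zeta_starlike zeta alpha f)
  (Ha : normalized_expansion a f)
  (Hn : (2 <= n)%nat)
  (Hden : bracket zeta n <> RtoC 1) :
  Cmod (a n) ^ 2 <=
    sum_n_m (fun k : nat =>
        (Cmod (RtoC (1 - 2 * alpha) + bracket zeta k) ^ 2
         - Cmod (bracket zeta k - 1) ^ 2) * Cmod (a k) ^ 2) 1 (n - 1)
    / Cmod (bracket zeta n - 1) ^ 2.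
Proof.
destruct Hf as [_ (g & (_ & h & (a' & b & Ha' & Hb & Hab) & Hh) & Hq)].
destruct Ha as (Ha0 & Ha1 & Ha).
assert (Hhexp : expands_on_disk (fun k => bracket zeta k * a k)%C h).
{ revert Hab; apply expands_ext; [|reflexivity]. intros k.
  rewrite (kernel_coef zeta b Hzeta Hb), (expands_unique a' a f Ha' Ha). ring. }
set (p := fun k => (1 * (bracket zeta k * a k) + (-1) * a k)%C).
set (q := fun k => (1 * (bracket zeta k * a k) + RtoC (1 - 2 * alpha) * a k)%C).
assert (HF : expands_on_disk p (fun z => 1 * h z + (-1) * f z)%C) by now apply expands_lin.
assert (HG : expands_on_disk q (fun z => 1 * h z + RtoC (1 - 2 * alpha) * f z)%C)
  by now apply expands_lin.
destruct (expands_tail _ _ HF) as (F & HF' & EF).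
destruct (expands_tail _ _ HG) as (G & HG' & EG).
assert (Hp0 : p O = RtoC 0) by (unfold p; rewrite Ha0; ring).
assert (Hq0 : q O = RtoC 0) by (unfold q; rewrite Ha0; ring).
assert (Hp1 : p 1%nat = RtoC 0) by (unfold p; rewrite Ha1; simpl; ring).
assert (Hq1 : q 1%nat = RtoC (2 - 2 * alpha)).
{ unfold q; rewrite Ha1. replace (2 - 2 * alpha) with (1 + (1 - 2 * alpha)) by ring.
  rewrite RtoC_plus. simpl; ring. }
assert (Hdom : forall z, Cmod z < 1 -> G z <> RtoC 0 /\ Cmod (F z) <= Cmod (G z)).
{ intros z Hz. destruct (Ceq_dec z 0) as [->|Nz].
  - (* At the origin the quotient gives no information, but [F 0 = p 1 = 0] and
       [G 0 = q 1 = 2 - 2 alpha]. *)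
    destruct (expands_tail _ _ HF') as (F1 & _ & EF1).
    destruct (expands_tail _ _ HG') as (G1 & _ & EG1).
    rewrite (EF1 0 Hz), (EG1 0 Hz), Hp1, Hq1.
    rewrite !Cmult_0_l, !Cplus_0_r, Cmod_0.
    split; [|apply Cmod_ge_0]. intros E; apply RtoC_inj in E; lra.
  - specialize (Hq z Hz). unfold starlike_quotient in Hq.
    destruct (Ceq_dec z 0) as [E|_]; [contradiction|]. rewrite <- Hh in Hq by exact Hz.
    destruct (half_plane_domination _ _ _ Halpha Hq) as [D1 D2].
    replace (h z + RtoC (1 - 2 * alpha) * f z)%C with (z * G z)%C in D1, D2.
    2:{ rewrite <- (Cplus_0_l (z * G z)), <- Hq0, <- EG by exact Hz. ring. }
    replace (h z - f z)%C with (z * F z)%C in D2.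
    2:{ rewrite <- (Cplus_0_l (z * F z)), <- Hp0, <- EF by exact Hz. ring. }
    split.
    + intros E. apply D1. rewrite E; ring.
    + rewrite !Cmod_mult in D2. apply Rmult_le_reg_l with (Cmod z); [|exact D2].
      now apply Cmod_gt_0. }
destruct n as [|[|m]]; [lia | lia |].
(* The coefficients of [F] and [G] are those of [p] and [q] shifted by one. *)
assert (K := dominated_coefficients _ _ F G m HF' HG' Hp1 Hdom).
rewrite sum_Sn in K. unfold sum_n in K.
rewrite (sum_n_m_S (fun k => Cmod (p k) ^ 2)), (sum_n_m_S (fun k => Cmod (q k) ^ 2)) in K.
replace (S (S m) - 1)%nat with (S m) by lia.
assert (Hd : 0 < Cmod (bracket zeta (S (S m)) - 1) ^ 2)
  by (apply pow_lt, Cmod_gt_0; now apply Cminus_eq_contra).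
apply Rmult_le_reg_r with (1 := Hd).
unfold Rdiv. rewrite Rmult_assoc, Rinv_l, Rmult_1_r by lra.
rewrite (sum_n_m_ext _ (fun k => plus (Cmod (q k) ^ 2) (scal (-1) (Cmod (p k) ^ 2)))).
2:{ intros k.
  change ((Cmod (RtoC (1 - 2 * alpha) + bracket zeta k) ^ 2 - Cmod (bracket zeta k - 1) ^ 2)
     * Cmod (a k) ^ 2 = Cmod (q k) ^ 2 + (-1) * Cmod (p k) ^ 2).
  replace (q k) with ((RtoC (1 - 2 * alpha) + bracket zeta k) * a k)%C by (unfold q; ring).
  replace (p k) with ((bracket zeta k - 1) * a k)%C by (unfold p; ring).
  rewrite !Cmod_mult. ring. }
rewrite sum_n_m_plus, (sum_n_m_scal_l (-1) (fun k => Cmod (p k) ^ 2)).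
replace (p (S (S m))) with ((bracket zeta (S (S m)) - 1) * a (S (S m)))%C in K
  by (unfold p; ring).
rewrite Cmod_mult, Rpow_mult_distr in K.
set (sq := sum_n_m (fun k => Cmod (q k) ^ 2) 1 (S m)) in *.
set (sp := sum_n_m (fun k => Cmod (p k) ^ 2) 1 (S m)) in *.
change (sp + Cmod (bracket zeta (S (S m)) - 1) ^ 2 * Cmod (a (S (S m))) ^ 2 <= sq) in K.
change (Cmod (a (S (S m))) ^ 2 * Cmod (bracket zeta (S (S m)) - 1) ^ 2 <= sq + (-1) * sp).
lra.
Qed.
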